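(* For every pair of integers $p\ge 3$ and $g\ge 1$, there is a connected acyclic oriented graph $H_{p,g}$ satisfying $$\operatorname{girth}(U(H_{p,g}))>g,\qquad \omega_{\mathrm{ao}}(H_{p,g})=\omega_{\mathrm{ro}}(H_{p,g})=3,$$ and $$p(H_{p,g})=p,\qquad \tau(H_{p,g})=r_{\mathrm{tr}}(p).$$
   Context: All graphs and digraphs are finite. An oriented graph is a loopless digraph with no pair of opposite arcs (and no parallel arcs); it is acyclic if it has no directed cycle. $U(H)$ denotes the underlying simple undirected graph of $H$; $H$ is connected if $U(H)$ is connected. The girth of a graph is the length of a shortest cycle ($\infty$ for a forest). A tournament is an orientation of a complete graph. A homomorphism $H\to T$ is a vertex map preserving every arc. $\vec{T}_k$ is the transitive tournament on $[k]$, with arcs $ij$ for $i<j$. For a nonempty acyclic oriented graph $H$, $p(H)$ is the maximum number of vertices on a directed path in $H$. The compressibility $\tau(H)$ is the least positive integer $n$ such that $H$ admits a homomorphism to every tournament of order $n$ (and $\tau(H)=\infty$ if there is no such $n$). $r_{\mathrm{tr}}(p)$ is the least $n$ such that every tournament of order $n$ contains $\vec{T}_p$ as a subtournament. Two vertices are linked if they are the endpoints of a directed path of length at most two, in either direction. A relative oriented clique of $H$ is a set of vertices that are pairwise linked in $H$; $\omega_{\mathrm{ro}}(H)$ is its maximum order. An oriented clique is an oriented graph in which every two vertices are linked within that graph; $\omega_{\mathrm{ao}}(H)$ is the maximum order of an oriented clique that is a subgraph of $H$. *)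

(* Defs.v *)
From mathcomp Require Import all_boot.
From mathcomp Require Import boolp.

Set Implicit Arguments.
Unset Strict Implicit.
Unset Printing Implicit Defensive.

Record digraph := Digraph { vertex :> finType; darc : rel vertex }.

(* Numerical parameters that may be infinite live in [option nat], where [None]
   stands for infinity. *)
Definition least (P : nat -> Prop) : option nat :=
  if pselect (exists n, `[< P n >]) is left exP then Some (ex_minn exP)
  else None.

Definition enat_gt (m : option nat) (g : nat) : bool :=
  if m is Some k then g < k else true.

Section Digraphs.

Variable H : digraph.

(* Taking x = y rules out loops. *)
Definition oriented : Prop := forall x y : H, darc x y -> ~~ darc y x.

Definition acyclic : Prop := forall c : seq H, ucycle (@darc H) c -> c = [::].

Definition underlying : rel H := [rel x y | darc x y || darc y x].

Definition connected : Prop :=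
  0 < #|H| /\ forall x y : H, connect underlying x y.

Definition tournament : Prop :=
  oriented /\ forall x y : H, x != y -> underlying x y.

(* Here [size s] is the number of vertices on the path s. *)
Definition max_path : nat :=
  \max_(s : #|H|.-bseq H | sorted (@darc H) s && uniq s) size s.

End Digraphs.

Arguments underlying : clear implicits.

Definition girth (V : finType) (e : rel V) : option nat :=
  least (fun n => exists c : seq V, [/\ size c = n, 2 < n & ucycle e c]).

Definition homomorphism (H T : digraph) (f : H -> T) : Prop :=
  forall x y, darc x y -> darc (f x) (f y).

Definition compressibility (H : digraph) : option nat :=
  least (fun n => 0 < n /\
    forall T : digraph, tournament T -> #|T| = n ->
      exists f : H -> T, homomorphism f).

Definition transitive_tournament (k : nat) : digraph :=
  @Digraph 'I_k (fun i j => i < j).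

(* In a tournament, the image of an injective homomorphism from a tournament is
   an induced copy of it. *)
Definition contains (T S : digraph) : Prop :=
  exists f : S -> T, injective f /\ homomorphism f.

Definition r_tr (p : nat) : option nat :=
  least (fun n => forall T : digraph, tournament T -> #|T| = n ->
    contains T (transitive_tournament p)).

(* The path is x :: s, of length [size s], at most 2. *)
Definition short_path (V : finType) (e : rel V) (x y : V) : bool :=
  [exists s : 2.-bseq V, [&& path e x s, uniq (x :: s) & last x s == y]].

Definition linked (V : finType) (e : rel V) (x y : V) : bool :=
  short_path e x y || short_path e y x.

Definition pairwise_linked (V : finType) (e : rel V) (A : {set V}) : bool :=
  [forall x in A, forall y in A, (x != y) ==> linked e x y].

Definition omega_ro (H : digraph) : nat :=
  \max_(A : {set H} | pairwise_linked (@darc H) A) #|A|.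

(* (A, F) is a subgraph of H with vertex set A and arc set F; it need not be
   induced. *)
Definition subgraph (H : digraph) (A : {set H}) (F : {set H * H}) : bool :=
  [forall u in F, [&& u.1 \in A, u.2 \in A & darc u.1 u.2]].

Definition omega_ao (H : digraph) : nat :=
  \max_(A : {set H} | [exists F : {set H * H},
      subgraph A F && pairwise_linked [rel x y | (x, y) \in F] A]) #|A|.

(* Main.v *)
(* A random sparse p-partite graph, with arcs directed from lower to higher
   classes, has few short cycles, and yet some arc joins any two not too small
   sets of vertices in different classes. Isolate one vertex on each short cycle.
   In a homomorphism to a tournament with at most 2^p vertices, each class has a
   popular image; these p images form a transitive tournament. Since a tournament
   with 2^p vertices always contains a transitive one on p vertices, mapping to
   all tournaments of order n is equivalent, for every n, to all of them
   containing a transitive tournament on p vertices. Adding arcs as long as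
   no short cycle appears makes the graph connected, and high girth bounds the
   relative oriented cliques. *)
Require Import Defs.
From mathcomp Require Import all_boot boolp zify.

Set Implicit Arguments.
Unset Strict Implicit.
Unset Printing Implicit Defensive.

(** * Counting functions, exponential estimates, cycles in lists *)

(** Points of [D] have [#|P|] choices each, all others [#|F|]; the factor [#|F| ^ #|D|] on the left
    avoids subtracting exponents. *)
Lemma card_ffun_constrained (E F : finType) (D : {set E}) (P : {set F}) :
  #|[set w : {ffun E -> F} | [forall e in D, w e \in P]]| * #|F| ^ #|D| =
  #|P| ^ #|D| * #|F| ^ #|E|.
Proof.
pose G e : pred F := fun x => (e \in D) ==> (x \in P).
have -> : #|[set w : {ffun E -> F} | [forall e in D, w e \in P]]| = #|family G|.
  by apply: eq_card => w; rewrite inE.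
rewrite card_family foldrE big_map big_enum /= (bigID (mem D)) /=.
rewrite (eq_bigr (fun=> #|P|)) => [|e eD]; last first.
  by apply: eq_card => x; rewrite /G unfold_in /= eD.
rewrite prod_nat_const (eq_bigr (fun=> #|F|)) => [|e eD]; last first.
  by apply: eq_card => x; rewrite /G unfold_in /= (negPf eD).
rewrite prod_nat_const -mulnA -expnD addnC; congr (_ * _ ^ _).
rewrite -(cardsC D); congr (_ + _); apply: eq_card => x; by rewrite !inE.
Qed.

Lemma leq_exp_base (m n e : nat) : m <= n -> m ^ e <= n ^ e.
Proof. by case: e => // e; rewrite leq_exp2r. Qed.

(** Bernoulli's inequality [1 + n/q <= (1 + 1/q)^n], cleared of denominators. *)
Lemma bernoulli_expn (q n : nat) : q ^ n * (q + n) <= q.+1 ^ n * q.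
Proof.
elim: n => [|n IHn]; first by rewrite addn0.
have : q ^ n <= q.+1 ^ n by exact: leq_exp_base.
rewrite !expnS; nia.
Qed.

(** That is, [q.+1] independent trials of success probability [1/(q+1)] all fail with probability at
    most one half. *)
Lemma double_expn_le (q : nat) : 2 * q ^ q.+1 <= q.+1 ^ q.+1.
Proof.
case: q => [|q] //; have := bernoulli_expn q.+1 q.+2.
set x := _ ^ _; set y := _ ^ _; nia.
Qed.

(** Used to see that a cycle never runs through the same edge twice. *)
Lemma next_next_neq (T : eqType) (c : seq T) (x : T) :
  uniq c -> 2 < size c -> x \in c -> next c (next c x) != x.
Proof.
move=> Uc c3 xc; case/rot_to: (xc) => i s def_s.
rewrite -!(next_rot i Uc) def_s.
have : uniq (x :: s) by rewrite -def_s rot_uniq.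
have : 2 < size (x :: s) by rewrite -def_s size_rot.
case: s {def_s} => [|y [|z s]] //= _; rewrite !inE !negb_or eqxx.
by case/and3P=> /and3P[xy xz _] _ _; rewrite (eq_sym y) (negPf xy) eqxx eq_sym.
Qed.

Lemma card_bigcup_le (I T : finType) (F : I -> {set T}) :
  #|\bigcup_i F i| <= \sum_i #|F i|.
Proof.
apply: (big_ind2 (fun (A : {set T}) n => #|A| <= n)) => // [|A n B k An Bk].
  by rewrite cards0.
by rewrite (leq_trans (leq_card_setU A B)) // leq_add.
Qed.

(** * Random layered graphs, by counting *)

Section RandomGraph.
Variables (V : finType) (l : V -> nat) (q : nat).
Implicit Type w : {ffun V * V -> 'I_q.+1}.

(** With [w] uniformly distributed, each pair with [l x < l y] is an arc independently with
    probability [1/(q+1)]. *)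
Definition rarc w : rel V := fun x y => (l x < l y) && (w (x, y) == ord0).
Definition rund w : rel V := fun x y => rarc w x y || rarc w y x.
Definition short_cycles w (k : nat) := [set c : k.+3.-tuple V | ucycleb (rund w) c].
Definition holes w (a : nat) :=
  [set AB : {set V} * {set V} |
    [&& a <= #|AB.1|, a <= #|AB.2| &
     [forall x in AB.1, forall y in AB.2, (l x < l y) && ~~ rarc w x y]]].

Let ed x y := if l x < l y then (x, y) else (y, x).

(** The [k.+3] edges of a cycle are distinct coordinates of [w], each of which has to be zero. *)
Lemma card_graphs_with_cycle k (c : k.+3.-tuple V) :
  #|[set w | ucycleb (rund w) c]| * q.+1 ^ k.+3 <= q.+1 ^ (#|V| ^ 2).
Proof.
have [Uc|nUc] := boolP (uniq c); last first.
  rewrite (_ : [set w | _] = set0) ?cards0 //.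
  by apply/setP=> w; rewrite !inE /ucycleb (negPf nUc) andbF.
pose D := [set ed x (next c x) | x in c].
have cD : #|D| = k.+3.
  rewrite card_in_imset; last first.
    move=> x y xc yc; rewrite /ed => E.
    (* Equal edges start at the same vertex or are traversed in opposite directions; [next_next_neq]
       excludes the latter. *)
    have [//|[xny nxy]] : x = y \/ x = next c y /\ next c x = y.
      by move: E; case: ifP; case: ifP => _ _ []; auto.
    have := @next_next_neq _ c y Uc; rewrite size_tuple -xny nxy eqxx.
    by move=> /(_ isT yc).
  by rewrite -[RHS](size_tuple c) -(card_uniqP Uc).
have := card_ffun_constrained (F := 'I_q.+1) D [set ord0].
rewrite cD cards1 exp1n mul1n card_prod mulnn card_ord => <-.
rewrite leq_mul2r subset_leq_card ?orbT //; apply/subsetP => w.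
rewrite !inE => /andP[cyc _]; apply/forall_inP => _ /imsetP[x xc ->].
rewrite inE; have := next_cycle cyc xc; rewrite /rund /rarc /ed.
by case: ltngtP => //= _; rewrite orbF.
Qed.

(** Summing over all [#|V| ^ k.+3] tuples bounds the mean number of cycles by [C ^ k.+3],
    independently of [q]. *)
Lemma sum_short_cycles k C : #|V| = C * q.+1 ->
  \sum_w #|short_cycles w k| <= C ^ k.+3 * q.+1 ^ (#|V| ^ 2).
Proof.
move=> cV.
have -> : \sum_w #|short_cycles w k| =
          \sum_(c : k.+3.-tuple V) #|[set w | ucycleb (rund w) c]|.
  under eq_bigr do rewrite -sum1dep_card.
  under [RHS]eq_bigr do rewrite -sum1dep_card.
  by rewrite (exchange_big_dep predT).
rewrite -(@leq_pmul2r (q.+1 ^ k.+3)) ?expn_gt0 // big_distrl /=.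
apply: (@leq_trans (\sum_(c : k.+3.-tuple V) q.+1 ^ (#|V| ^ 2))).
  by apply: leq_sum => c _; exact: card_graphs_with_cycle.
by rewrite sum_nat_const card_tuple {1}cV expnMn mulnAC.
Qed.

(** Union bound over [4 ^ #|V|] pairs of sets: each is a hole with probability at most [2 ^ -b],
    since at least [q.+1 * b] coordinates must avoid zero. *)
Lemma sum_holes a b : a ^ 2 = q.+1 * b -> 2 * #|V| < b ->
  2 * \sum_w #|holes w a| <= q.+1 ^ (#|V| ^ 2).
Proof.
move=> ab bV.
have hole1 (AB : {set V} * {set V}) :
  #|[set w | AB \in holes w a]| * 2 ^ b <= q.+1 ^ (#|V| ^ 2).
  have [/andP[aA aB]|nAB] := boolP ((a <= #|AB.1|) && (a <= #|AB.2|)); last first.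
    rewrite (_ : [set w | _] = set0) ?cards0 //.
    by apply/setP=> w; rewrite !inE andbA (negPf nAB).
  pose D := setX AB.1 AB.2.
  have aD : q.+1 * b <= #|D| by rewrite cardsX -ab -mulnn leq_mul.
  have sub : #|[set w | AB \in holes w a]| <=
     #|[set w : {ffun V * V -> 'I_q.+1} | [forall e in D, w e \in ~: [set ord0]]]|.
    apply/subset_leq_card/subsetP => w; rewrite !inE => /and3P[_ _ H].
    apply/forall_inP => -[x y] /setXP[/= xA yB].
    move/forall_inP/(_ _ xA)/forall_inP/(_ _ yB)/andP: H => [lxy].
    by rewrite /rarc lxy !inE.
  have := card_ffun_constrained (F := 'I_q.+1) D (~: [set ord0]).
  rewrite cardsC1 card_prod mulnn !card_ord /= => E.
  (* Each of [b] blocks of [q.+1] factors gains a factor 2; for the remaining factors [q <= q.+1] is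
     enough. *)
  have dq : 2 ^ b * q ^ #|D| <= q.+1 ^ #|D|.
    rewrite -(subnK aD) !(expnD _ (_ - _)) mulnCA leq_mul //.
      by exact: leq_exp_base.
    by rewrite !expnM -expnMn leq_exp_base // double_expn_le.
  rewrite -(@leq_pmul2r (q.+1 ^ #|D|)) ?expn_gt0 //.
  rewrite mulnAC (@leq_trans (q ^ #|D| * q.+1 ^ (#|V| ^ 2) * 2 ^ b)) //.
    by rewrite -E !leq_mul.
  by rewrite mulnAC mulnC leq_mul // mulnC.
have -> : \sum_w #|holes w a| = \sum_AB #|[set w | AB \in holes w a]|.
  under eq_bigr do rewrite -sum1_card.
  under [RHS]eq_bigr do rewrite -sum1dep_card.
  by rewrite (exchange_big_dep predT).
rewrite -(@leq_pmul2r (2 ^ b)) ?expn_gt0 // -mulnA big_distrl /=.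
apply: (@leq_trans (2 * (2 ^ (2 * #|V|) * q.+1 ^ (#|V| ^ 2)))).
  rewrite leq_mul2l /=.
  apply: (@leq_trans (\sum_(AB : {set V} * {set V}) q.+1 ^ (#|V| ^ 2))).
    by apply: leq_sum => AB _; exact: hole1.
  rewrite sum_nat_const card_prod -!cardsT -powersetT card_powerset cardsT.
  by rewrite -expnD addnn mul2n.
by rewrite mulnA -expnS mulnC leq_mul2l leq_exp2l // bV orbT.
Qed.

Lemma sparse_graph_without_holes (g a b C : nat) :
    #|V| = C * q.+1 -> a ^ 2 = q.+1 * b -> 2 * #|V| < b ->
  exists w, holes w a = set0 /\
    \sum_(k < g) #|short_cycles w k| <= 2 * \sum_(k < g) C ^ k.+3.
Proof.
move=> cV ab bV; set K := \sum_(k < g) C ^ k.+3.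
(* The weights are such that a graph lighter than average has no hole at all. *)
pose weight w := \sum_(k < g) #|short_cycles w k| + (2 * K).+1 * #|holes w a|.
have [w wK|heavy] := pickP (fun w => weight w <= 2 * K).
  exists w; split; last by rewrite (leq_trans _ wK) // leq_addr.
  apply/eqP; rewrite -cards_eq0; move: wK; rewrite /weight; nia.
have: \sum_w weight w <= K * q.+1 ^ (#|V| ^ 2) + (2 * K).+1 * \sum_w #|holes w a|.
  rewrite big_split /= -big_distrr /= leq_add2r exchange_big big_distrl /=.
  by apply: leq_sum => k _; exact: sum_short_cycles.
(* If every weight exceeded [2 * K], the mean would be at least [2 * K + 1], but it is at most
   [K + (2 * K + 1) / 2]. *)
have: (2 * K).+1 * q.+1 ^ (#|V| ^ 2) <= \sum_w weight w.
  have -> : q.+1 ^ (#|V| ^ 2) = #|{: {ffun V * V -> 'I_q.+1}}|.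
    by rewrite card_ffun card_prod card_ord mulnn.
  rewrite mulnC -sum_nat_const.
  by apply: leq_sum => w _; rewrite ltnNge heavy.
have := sum_holes ab bV.
have : 0 < q.+1 ^ (#|V| ^ 2) by rewrite expn_gt0.
set x := _ ^ _; set y := \sum_w #|_|; nia.
Qed.

End RandomGraph.

(** * Layered graphs: adding arcs, and directed paths from transversality *)

Section Layered.
Variables (V : finType) (p : nat) (l : V -> 'I_p).
Implicit Type e : rel V.

Definition sym_closure e : rel V := fun x y => e x y || e y x.
Arguments sym_closure e x y /.

Definition layered e := forall x y, e x y -> l x < l y.

Definition no_cycle_upto g e :=
  forall c : seq V, 2 < size c <= g -> ~~ ucycleb (sym_closure e) c.

(* In terms of homomorphisms: every image of the graph with at most n vertices
   that has no loops or opposite arcs contains a transitive tournament. *)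
Definition transversal n e := forall (C : finType) (c : V -> C), #|C| <= n ->
  exists t : 'I_p -> C, forall i j : 'I_p, i < j ->
    exists x y, [/\ l x = i, c x = t i, l y = j, c y = t j & e x y].

Definition add_arc e u v : rel V := fun x y => e x y || ((x == u) && (y == v)).
Arguments add_arc e u v x y /.

Lemma sym_closure_connect_sym e : connect_sym (sym_closure e).
Proof. by apply: sym_connect_sym => x y; rewrite /= orbC. Qed.

(** A new short cycle would contain the new edge, and its remaining edges would connect [u] and [v]
    in the old graph. *)
Lemma no_cycle_add_arc g e u v :
  no_cycle_upto g e -> ~~ connect (sym_closure e) u v ->
  no_cycle_upto g (add_arc e u v).
Proof.
move=> girth_e nuv c sz_c; apply/negP => /andP[cyc Uc].
have /negP := girth_e c sz_c; apply; rewrite /ucycleb Uc andbT.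
apply: cycle_from_next => // x xc; apply/negPn/negP => nx.
have nuv' : ~~ connect (sym_closure e) v u by rewrite sym_closure_connect_sym.
(* Rotate the cycle so that it starts with the new edge, from [x] to [y]. *)
case/rot_to: (xc) => i s def_s.
have : uniq (x :: s) by rewrite -def_s rot_uniq.
have : 2 < size (x :: s) by rewrite -def_s size_rot; case/andP: sz_c.
have : cycle (sym_closure (add_arc e u v)) (x :: s) by rewrite -def_s rot_cycle.
have : ~~ sym_closure e x (next (x :: s) x) by rewrite -def_s next_rot.
case: s {def_s nx} => [|y [|z s]] //=; rewrite eqxx rcons_path /=.
move=> nxy /and3P[exy eyz /andP[ezs elx]] _.
rewrite !inE !negb_or -!andbA => /and5P[xy xz xs yz /andP[ys _]].
pose w := last z s.
have ws : w \in z :: s by exact: mem_last.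
have xw : x != w by apply: contraNneq xs => xw; move: ws; rewrite -xw inE (negPf xz).
have yw : y != w by apply: contraNneq ys => yw; move: ws; rewrite -yw inE (negPf yz).
have xy_uv : x = u /\ y = v \/ x = v /\ y = u.
  move: exy nxy => /=; case: (e x y); case: (e y x) => //=.
  by case/orP=> /andP[/eqP-> /eqP->]; auto.
have new_uv a b : sym_closure (add_arc e u v) a b -> ~~ sym_closure e a b ->
    a = x /\ b = y \/ a = y /\ b = x.
  rewrite /=; case: (e a b); case: (e b a) => //=.
  by case/orP=> /andP[/eqP-> /eqP->]; case: xy_uv => -[-> ->]; auto.
(* The rest of the cycle, from [y] through [z] to [w] and back to [x], uses old edges only: [z :: s]
   avoids [x], and [w] differs from [y]. *)
have cyx : connect (sym_closure e) y x.
  apply: (@connect_trans _ _ w); last first.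
    apply: connect1; apply: contraTT elx => nwx; apply/negP => /new_uv.
    by case=> // -[wy _]; [move: xw | move: yw]; rewrite -wy eqxx.
  apply/connectP; exists (z :: s) => //.
  have : path (sym_closure (add_arc e u v)) y (z :: s) by rewrite /= eyz.
  apply: (@sub_in_path _ (predC1 x)) => [a b|].
    rewrite !inE => ax bx /new_uv ab; apply: contraT => /ab.
    by case=> -[a' b']; [rewrite a' eqxx in ax | rewrite b' eqxx in bx].
  rewrite /= eq_sym xy eq_sym xz /=; apply/allP => a sa /=.
  by apply: contraNneq xs => <-.
by move: cyx; case: xy_uv => -[-> ->]; apply/negP.
Qed.

(** A graph with the most arcs works: an arc between two components could still be added without
    creating a cycle. *)
Lemma maximal_layered_graph g n e :
    layered e -> no_cycle_upto g e -> transversal n e ->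
  exists e', [/\ layered e', no_cycle_upto g e', transversal n e' &
    forall u v, l u < l v -> connect (sym_closure e') u v].
Proof.
move=> lay_e girth_e tr_e.
pose size_of e' := #|[set u | e' u.1 u.2]|.
pose P k := `[< exists e', [/\ layered e', no_cycle_upto g e', transversal n e' &
                              size_of e' = k] >].
have exP : exists k, P k by exists (size_of e); apply/asboolP; exists e.
have ubP k : P k -> k <= #|{: V * V}|.
  by case/asboolP=> e' [_ _ _ <-]; exact: max_card.
case: (ex_maxnP exP ubP) => k /asboolP[e' [lay' girth' tr' <-]] max'.
exists e'; split=> // u v luv; apply: contraT => nuv.
have ne : ~~ e' u v by apply: contra nuv => euv; apply: connect1; rewrite /= euv.
suff : size_of (add_arc e' u v) <= size_of e'.
  rewrite leqNgt => /negP[]; apply: proper_card; apply/properP; split.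
    by apply/subsetP => -[x y]; rewrite !inE /= => ->.
  by exists (u, v); rewrite !inE /= ?eqxx ?orbT.
apply: max'; apply/asboolP; exists (add_arc e' u v); split=> //.
- by move=> x y /orP[/lay' //|/andP[/eqP-> /eqP->]].
- exact: no_cycle_add_arc.
move=> C c /(tr' C c)[t Ht]; exists t => i j /Ht[x [y [? ? ? ? exy]]].
by exists x, y; split=> //=; rewrite exy.
Qed.

(* Colour a vertex by whether a directed path meeting all lower layers ends there:
   the colours that the transversal picks must be [true] in every layer. *)
Lemma transversal_path n e : transversal n e -> 1 < n -> 1 < p ->
  exists x s, path e x s /\ size s = p.-1.
Proof.
move=> tr_e n2 p2.
pose reached x := `[< exists y s, [/\ path e y s, last y s = x & size s = l x] >].
have [|t Ht] := tr_e bool reached; first by rewrite card_bool.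
have t1 i (ip : i < p) : t (Ordinal ip) = true.
  elim: i ip => [|i IHi] ip.
    have [x [y [lx <- _ _ _]]] := Ht (Ordinal ip) (Ordinal p2) isT.
    by apply/asboolP; exists x, [::]; rewrite lx.
  have ip' : i < p by exact: ltnW.
  have [x [y [lx tx ly <- exy]]] := Ht (Ordinal ip') (Ordinal ip) (leqnn _).
  move: tx; rewrite IHi => /asboolP[z [s [zs sx size_s]]].
  apply/asboolP; exists z, (rcons s y).
  by rewrite rcons_path zs sx exy last_rcons size_rcons size_s lx ly.
have p0 : 0 < p by exact: ltnW.
have pp : p.-1 < p by rewrite ltn_predL.
have [|x [y [_ _ ly ty _]]] := Ht (Ordinal p0) (Ordinal pp).
  by rewrite /= -subn1 subn_gt0.
move: ty; rewrite t1 => /asboolP[z [s [zs _ size_s]]].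
by exists z, s; rewrite size_s ly.
Qed.

End Layered.

Arguments sym_closure V e x y /.

Lemma exists_layered_graph (p n g : nat) :
  exists (m : nat) (e : rel ('I_p * 'I_m)),
    [/\ layered fst e, no_cycle_upto g e & transversal fst n e].
Proof.
(* [C] does not involve [q], so [q] can be the bound on the number of short cycles. Since [d]
   exceeds [4 * p * n.+1], twice the order [C * q.+1] is below [d ^ 2 * q.+1]. Since [q < a], a
   layer of [m] vertices keeps more than [n * a] of them outside [S]. *)
pose d := (4 * p * n.+1).+1; pose C := 2 * p * n.+1 * d.
pose q := 2 * \sum_(k < g) C ^ k.+3; pose a := d * q.+1.
pose m := 2 * n.+1 * a; exists m; pose V := ('I_p * 'I_m)%type.
pose l (x : V) : nat := x.1.
have cV : #|{: V}| = C * q.+1 by rewrite card_prod !card_ord /m /C /a; nia.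
have [|||w [no_hole few_cycles]] :=
  @sparse_graph_without_holes V l q g a (d ^ 2 * q.+1) C.
- exact: cV.
- by rewrite /a; nia.
- by rewrite cV /C -mulnn /d; nia.
(* The starting point of each short cycle is isolated rather than removed, which keeps the vertex
   type. *)
pose S := \bigcup_(k < g) [set thead c | c in short_cycles l w k].
have cS : #|S| <= q.
  apply: leq_trans (card_bigcup_le _) (leq_trans _ few_cycles).
  by apply: leq_sum => k _; exact: leq_imset_card.
pose e : rel V := [rel x y | [&& x \notin S, y \notin S & rarc l w x y]].
exists e; split.
- by move=> x y /and3P[_ _ /andP[]].
- move=> c /andP[]; case def_k: (size c) => [|[|[|k]]] // _ kg.
  apply/negP => /andP[cyc Uc].
  have kg' : k < g by rewrite (leq_trans _ kg) // ltnS leqW.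
  pose ct : k.+3.-tuple V := Tuple (introT eqP def_k).
  have hS : thead ct \in S.
    apply/bigcupP; exists (Ordinal kg') => //; apply/imsetP; exists ct => //.
    rewrite inE /ucycleb Uc andbT; apply: sub_cycle cyc => x y.
    by case/orP=> /and3P[_ _ exy]; rewrite /rund exy ?orbT.
  have tc : thead ct \in c by exact: mem_tnth.
  by case/orP: (next_cycle cyc tc) => /and3P[]; rewrite hS.
move=> D c cD.
(* Pigeonhole: otherwise layer [i] has at most [n * a + q] vertices, fewer than [m]. *)
have big i : exists t, a <= #|[set x : V | [&& x.1 == i, x \notin S & c x == t]]|.
  apply/existsP; apply: contraT => /existsPn small.
  have : #|[set x : V | x.1 == i]| <= #|D| * a + #|S|.
    rewrite -(cardsID S) addnC leq_add ?subset_leq_card ?subsetIr //.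
    rewrite -sum1_card (partition_big c predT) //= -sum_nat_const leq_sum // => t _.
    rewrite sum1dep_card ltnW // ltnNge.
    apply: contra (small t) => /leq_trans; apply; apply: subset_leq_card.
    by apply/subsetP => x; rewrite !inE => /andP[/andP[-> ->] ->].
  have -> : #|[set x : V | x.1 == i]| = m.
    have -> : [set x : V | x.1 == i] = setX [set i] setT.
      by apply/setP => -[x y]; rewrite !inE andbT.
    by rewrite cardsX cards1 cardsT card_ord mul1n.
  have : #|D| * a <= n * a by rewrite leq_mul2r cD orbT.
  have : q < a by rewrite /a leq_pmull.
  rewrite /m; move: cS; move: (#|S|) (#|D| * a) => s da; nia.
have [t Ht] := fin_all_exists big; exists t => i j ij.
set A := fun i => [set x : V | [&& x.1 == i, x \notin S & c x == t i]].
have : (A i, A j) \notin holes l w a by rewrite no_hole inE.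
rewrite inE /= !Ht /= => /forall_inPn[x xA /forall_inPn[y yA]].
move: xA yA; rewrite !inE => /and3P[/eqP xi xS /eqP cx] /and3P[/eqP yj yS /eqP cy].
rewrite /l xi yj ij /= negbK => exy.
by exists x, y; rewrite /e /= xS yS exy.
Qed.

(** * Longest paths and oriented cliques in layered digraphs *)

Section LayeredDigraph.
Variables (H : digraph) (p : nat) (l : H -> 'I_p).
Hypothesis lay : layered l (@darc H).

Lemma layered_oriented : oriented H.
Proof. by move=> x y /lay lxy; apply/negP => /lay; rewrite ltnNge ltnW. Qed.

Lemma layered_acyclic : acyclic H.
Proof.
case=> [|x s] //= /andP[cyc _].
have : path ltn (l x) [seq val (l i) | i <- rcons s x].
  by rewrite -[path _ _ _]/(path _ ((fun i => val (l i)) x) _) path_map;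
     apply: sub_path cyc => a b /lay.
move/(order_path_min ltn_trans)/allP/(_ (l x)).
by rewrite map_rcons mem_rcons inE eqxx /= ltnn => /(_ isT).
Qed.

Lemma layered_max_path x s : path (@darc H) x s -> size s = p.-1 -> max_path H = p.
Proof.
move=> xs size_s; have p0 : 0 < p by case: (l x) => i; exact: leq_ltn_trans.
have sorted_l (t : seq H) : sorted (@darc H) t -> sorted ltn [seq val (l i) | i <- t].
  by rewrite sorted_map; apply: sub_sorted => a b /lay.
have sorted_size (t : seq H) : sorted (@darc H) t -> size t <= p.
  move/sorted_l; rewrite ltn_sorted_uniq_leq => /andP[Ut _].
  rewrite -(size_map (fun i => val (l i))) -[p in _ <= p](size_iota 0).
  by apply: uniq_leq_size => // _ /mapP[y _ ->]; rewrite mem_iota ltn_ord.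
apply/eqP; rewrite eqn_leq; apply/andP; split.
  by apply/bigmax_leqP => t /andP[/sorted_size].
have Us : uniq (x :: s).
  have : sorted (@darc H) (x :: s) by [].
  by move/sorted_l; rewrite ltn_sorted_uniq_leq => /andP[/map_uniq].
have sH : size (x :: s) <= #|H| by rewrite -(card_uniqP Us) max_card.
apply: leq_trans (leq_bigmax_cond (Bseq sH) _) => /=; last by rewrite xs.
by rewrite size_s prednK.
Qed.

Lemma short_path_cases x y : short_path (@darc H) x y -> x != y ->
  darc x y \/ exists2 z, darc x z & darc z y.
Proof.
case/existsP=> -[[|z [|w [|? ?]]] //= _].
- by move->.
- by case/and3P=> /andP[xz _] _ /eqP <-; left.
- by case/and3P=> /and3P[xz zw _] _ /eqP <-; right; exists z.
Qed.

Lemma linked_layers x y : x != y -> linked (@darc H) x y ->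
  l x < l y /\ (darc x y \/ exists2 z, darc x z & darc z y) \/
  l y < l x /\ (darc y x \/ exists2 z, darc y z & darc z x).
Proof.
have lt u v : (darc u v \/ exists2 z, darc u z & darc z v) -> l u < l v.
  by case=> [/lay //|[z /lay uz /lay]]; exact: ltn_trans.
move=> xy /orP[|] sp; [left|right]; (split; [apply: lt|]); 
  by apply: short_path_cases => //; rewrite eq_sym.
Qed.

Hypothesis girth6 : no_cycle_upto 6 (@darc H).

Definition linked_up (x y : H) := darc x y \/ exists2 z, darc x z & darc z y.

(** Distinctness of the listed vertices comes from their layers or from disequalities in the
    context. *)
Ltac close_cycle cyc c :=
  exfalso; apply: (@cyc c) => //;
  [ repeat match goal with H : is_true (darc _ _) |- _ =>
      move: (lay H); clear H; intro end;
    rewrite /= !inE !negb_or ?andbT;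
    repeat (apply/andP; split); apply/eqP => ?; subst; first [congruence | lia]
  | rewrite /=;
    repeat match goal with H : is_true (darc _ _) |- _ => rewrite H; clear H end;
    by rewrite ?orbT ].

(* Otherwise the union of the three connecting paths contains a cycle, on at most
   6 vertices. *)
Lemma linked_up_triple x y z :
  linked_up x y -> linked_up y z -> linked_up x z -> darc x y /\ darc y z.
Proof.
have cyc (c : seq H) : 2 < size c <= 6 -> uniq c ->
    cycle (sym_closure (@darc H)) c -> False.
  by move=> sc Uc cc; move: (girth6 sc); rewrite /ucycleb cc Uc.
case=> [xy|[u xu uy]]; case=> [yz|[v yv vz]] //; case=> [xz|[w xw wz]].
- close_cycle cyc [:: x; y; v; z].
(* The midpoint [w] may lie on the path through [y], which gives a shorter cycle; likewise below. *)
- have [E|/eqP wy] := eqVneq w y; first by rewrite E in xw wz; close_cycle cyc [:: y; v; z].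
  have [E|/eqP wv] := eqVneq w v; first by rewrite E in xw wz; close_cycle cyc [:: x; y; v].
  close_cycle cyc [:: x; y; v; z; w].
- close_cycle cyc [:: x; u; y; z].
- have [E|/eqP wu] := eqVneq w u; first by rewrite E in xw wz; close_cycle cyc [:: u; y; z].
  have [E|/eqP wy] := eqVneq w y; first by rewrite E in xw wz; close_cycle cyc [:: x; u; y].
  close_cycle cyc [:: x; u; y; z; w].
- close_cycle cyc [:: x; u; y; v; z].
- have [E|/eqP wu] := eqVneq w u; first by rewrite E in xw wz; close_cycle cyc [:: u; y; v; z].
  have [E|/eqP wy] := eqVneq w y; first by rewrite E in xw wz; close_cycle cyc [:: x; u; y].
  have [E|/eqP wv] := eqVneq w v; first by rewrite E in xw wz; close_cycle cyc [:: x; u; y; v].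
  close_cycle cyc [:: x; u; y; v; z; w].
Qed.

(** Among four pairwise linked vertices in layer order, the triple [a, b, c] yields arcs [ab] and
    [bc], and [a, c, d] yields [ac]: a triangle. *)
Lemma omega_ro_le3 : omega_ro H <= 3.
Proof.
apply/bigmax_leqP => A /forall_inP linkA; rewrite leqNgt; apply/negP => A4.
have lk x y : x \in A -> y \in A -> x != y ->
    l x < l y /\ linked_up x y \/ l y < l x /\ linked_up y x.
  move=> xA yA xy; apply: linked_layers => //.
  by move/forall_inP: (linkA x xA) => /(_ y yA)/implyP; apply.
have up x y : x \in A -> y \in A -> x != y -> l x <= l y -> linked_up x y.
  by move=> xA yA xy lxy; case: (lk x y xA yA xy) => -[] //; rewrite ltnNge lxy.
pose s := sort (relpre l leq) (enum A).
have sA : {subset s <= A} by move=> x; rewrite mem_sort mem_enum.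
have Us : uniq s by rewrite sort_uniq enum_uniq.
have : sorted (relpre l leq) s by apply: sort_sorted => x y; exact: leq_total.
have : 3 < size s by rewrite size_sort -cardE.
case: s sA Us => [|a [|b [|c [|d s]]]] //= sA + _ /and4P[lab lbc lcd _].
rewrite !inE !negb_or -!andbA => /and5P[ab ac ad _ /and5P[bc bd _ cd _]].
have [aA bA cA dA] : [/\ a \in A, b \in A, c \in A & d \in A].
  by split; apply: sA; rewrite !inE eqxx ?orbT.
have lac := leq_trans lab lbc; have lad := leq_trans lac lcd.
have [dab dbc] := linked_up_triple (up a b aA bA ab lab) (up b c bA cA bc lbc)
  (up a c aA cA ac lac).
have [dac _] := linked_up_triple (up a c aA cA ac lac) (up c d cA dA cd lcd)
  (up a d aA dA ad lad).
have := @girth6 [:: a; b; c] isT.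
by rewrite /ucycleb /= dab dbc dac !orbT !inE !negb_or ab ac bc.
Qed.

Lemma omega_ao_le_ro : omega_ao H <= omega_ro H.
Proof.
apply/bigmax_leqP => A /existsP[F /andP[/forall_inP sub linkA]].
apply: (leq_bigmax_cond (F := fun A : {set H} => #|A|)).
apply/forall_inP => x xA; apply/forall_inP => y yA; apply/implyP => xy.
have short u v : short_path [rel x y | (x, y) \in F] u v -> short_path (@darc H) u v.
  case/existsP=> s /and3P[us Us vs]; apply/existsP; exists s; rewrite Us vs /= andbT.
  by apply: sub_path us => a b /= /sub /and3P[].
move/forall_inP: linkA => /(_ x xA)/forall_inP/(_ y yA)/implyP/(_ xy).
by case/orP=> /short; rewrite /linked => ->; rewrite ?orbT.
Qed.

(** A directed path on three vertices is an oriented clique, its ends being linked through [y]. *)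
Lemma omega_ao_ge3 (x y z : H) : darc x y -> darc y z -> 3 <= omega_ao H.
Proof.
move=> xy yz; have [lxy lyz] := (lay xy, lay yz).
have neq u v : l u < l v -> u != v by apply: contraTneq => ->; rewrite ltnn.
have [[nxy nyz] nxz] := (neq _ _ lxy, neq _ _ lyz, neq _ _ (ltn_trans lxy lyz)).
pose A := [set x; y; z]; have cA : #|A| = 3.
  by rewrite /A setUC cardsU1 cards2 !inE negb_or nxy eq_sym nxz eq_sym nyz.
rewrite -cA; apply: (leq_bigmax_cond (F := fun A : {set H} => #|A|)).
pose F := [set (x, y); (y, z)]; apply/existsP; exists F; apply/andP; split.
  by apply/forall_inP => u; rewrite !inE => /orP[] /eqP -> /=; rewrite !eqxx ?orbT.
pose e := [rel x y | (x, y) \in F].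
have [exy eyz] : e x y /\ e y z by rewrite /= !inE !eqxx orbT.
have short1 u v : u != v -> e u v -> short_path e u v.
  move=> uv euv; apply/existsP; exists (@Bseq 2 _ [:: v] isT).
  by apply/and3P; split; [exact/andP | rewrite /= inE uv | rewrite /=].
have sxz : short_path e x z.
  apply/existsP; exists (@Bseq 2 _ [:: y; z] isT).
  apply/and3P; split; [exact/and3P | | exact: eqxx].
  by rewrite /= !inE negb_or nxy nxz nyz.
have [sxy syz] := (short1 _ _ nxy exy, short1 _ _ nyz eyz).
apply/forall_inP => u uA; apply/forall_inP => v vA; apply/implyP => uv.
move: uA vA uv; rewrite /linked !inE -!orbA.
by do 2![case/or3P=> /eqP->]; rewrite ?eqxx ?sxy ?syz ?sxz ?orbT.
Qed.

End LayeredDigraph.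

(** * Transitive subtournaments *)

(** In a set of [2 ^ k.+1] vertices, any [v] has [2 ^ k] out-neighbours or [2 ^ k] in-neighbours; it
    goes before or after a sequence found among them. *)
Lemma transitive_seq_in_tournament (T : digraph) (k : nat) (X : {set T}) :
    tournament T -> 2 ^ k <= #|X| ->
  exists s, [/\ size s = k, {subset s <= X} & pairwise (@darc T) s].
Proof.
move=> [_ totT]; elim: k X => [|k IHk] X XK; first by exists [::].
have [v vX] : exists v, v \in X.
  by apply/set0Pn; rewrite -card_gt0 (leq_trans _ XK) // expn_gt0.
pose Out := [set y in X | darc v y]; pose In := [set y in X | darc y v].
have cX : #|X| <= (#|Out| + #|In|).+1.
  rewrite (cardsD1 v) vX ltnS (leq_trans _ (leq_card_setU Out In)) //.
  apply/subset_leq_card/subsetP => y; rewrite !inE eq_sym => /andP[vy ->].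
  exact: totT.
have [oK|iK] : 2 ^ k <= #|Out| \/ 2 ^ k <= #|In|.
  by move: XK cX; rewrite expnS; case: leqP; auto; case: leqP; auto; lia.
  have [s [size_s sX ps]] := IHk _ oK; exists (v :: s); split=> /=.
  - by rewrite size_s.
  - move=> y; rewrite inE => /predU1P[-> //|/sX]; by rewrite inE => /andP[].
  - by rewrite ps andbT; apply/allP => y /sX; rewrite inE => /andP[].
have [s [size_s sX ps]] := IHk _ iK; exists (rcons s v); split=> /=.
- by rewrite size_rcons size_s.
- move=> y; rewrite mem_rcons inE => /predU1P[-> //|/sX]; by rewrite inE => /andP[].
- by rewrite pairwise_rcons ps andbT; apply/allP => y /sX; rewrite inE => /andP[].
Qed.

(** Injectivity is automatic: distinct vertices of the source are joined by an arc, and [T] has no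
    loop. *)
Lemma contains_transitive_tournament (T : digraph) (p : nat)
    (f : transitive_tournament p -> T) :
  oriented T -> homomorphism f -> contains T (transitive_tournament p).
Proof.
move=> orT homf; exists f; split=> // i j fij.
have irr x : ~~ @darc T x x by apply/negP => xx; have := orT x x xx; rewrite xx.
apply/val_inj; case: (ltngtP i j) => // ij.
  by have := homf i j ij; rewrite fij (negPf (irr _)).
by have := homf j i ij; rewrite fij (negPf (irr _)).
Qed.

Lemma large_tournament_contains (T : digraph) (p : nat) :
  tournament T -> 2 ^ p <= #|T| -> contains T (transitive_tournament p).
Proof.
move=> tT Tp; have [orT _] := tT.
have [|s [size_s _ ps]] := @transitive_seq_in_tournament T p setT tT.
  by rewrite cardsT.
(* An empty sequence provides no default for [nth]; then [p = 0] and the map has empty domain. *)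
case: s size_s ps => [|x s] size_s ps.
  rewrite -size_s; exists (fun i : 'I_0 => False_rect T (notF (ltn_ord i))).
  by split; case.
apply: (@contains_transitive_tournament T p (fun i => nth x (x :: s) i)) => //.
move=> i j ij; move/(pairwiseP x): ps; apply=> //; by rewrite inE size_s.
Qed.

Theorem theorem1p1 (p g : nat) (hp : 3 <= p) (hg : 1 <= g) :
  exists H : digraph,
    [/\ oriented H, acyclic H & connected H] /\
    [/\ enat_gt (girth (underlying H)) g,
        omega_ao H = 3, omega_ro H = 3,
        max_path H = p &
        compressibility H = r_tr p].
Proof.
(* Excluding cycles up to length 6 controls the cliques; [2 ^ p] images suffice, as larger
   tournaments contain the transitive one anyway. *)
have [m [e0 [lay0 girth0 tr0]]] := exists_layered_graph p (2 ^ p) (maxn g 6).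
have [e [lay girth_e tr_e conn]] := maximal_layered_graph lay0 girth0 tr0.
pose l (x : 'I_p * 'I_m) := x.1.
pose H := @Digraph ('I_p * 'I_m)%type e.
have layH : @layered H p l (@darc H) by [].
have girth6 : no_cycle_upto 6 (@darc H).
  by move=> c /andP[c2 c6]; apply: girth_e; rewrite c2 leq_max c6 orbT.
have p2 : 1 < p by exact: ltnW.
have [x [s [xs size_s]]] : exists x s, path e x s /\ size s = p.-1.
  by apply: transversal_path tr_e _ _ => //; rewrite (@ltn_exp2l 2 0) // ltnW.
have ao3 : 3 <= omega_ao H.
  have : 1 < size s by rewrite size_s; case: (p) hp => [|[|[|]]].
  case: s xs {size_s} => [|y [|z s]] //= /and3P[xy yz _] _.
  exact: (omega_ao_ge3 layH xy yz).
have ro3 := omega_ro_le3 layH girth6; have aoro := omega_ao_le_ro H.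
(* A single colour shows that any two layers are joined by an arc, so no layer is empty. *)
have [t Ht] : exists t : 'I_p -> unit, forall i j : 'I_p, i < j ->
    exists x y, [/\ l x = i, tt = t i, l y = j, tt = t j & e x y].
  by apply: (tr_e unit (fun=> tt)); rewrite card_unit expn_gt0.
exists H; split; split.
- exact: layered_oriented layH.
- exact: layered_acyclic layH.
- split; first by apply/card_gt0P; exists x.
  have conn_ne u v : l u != l v -> connect (sym_closure e) u v.
    rewrite neq_ltn => /orP[] /conn //; by rewrite sym_closure_connect_sym.
  move=> u v; rewrite -[connect _ u v]/(connect (sym_closure e) u v).
  (* Vertices of one layer are connected through a vertex of another. *)
  have [luv|/conn_ne //] := eqVneq (l u) (l v).
  have [y [z [ly _ lz _ _]]] := Ht (Ordinal (ltnW p2)) (Ordinal p2) isT.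
  have [w uw] : exists w, l u != l w.
    have [uy|] := eqVneq (l u) (l y); last by exists y.
    by exists z; rewrite uy ly lz.
  apply: (@connect_trans _ _ w); apply: conn_ne => //.
  by rewrite eq_sym -luv.
- rewrite /girth /least; case: pselect => //= ex; case: ex_minnP => k.
  case/asboolP=> c [<- c2 cyc_c] _; rewrite ltnNge; apply/negP => cg.
  have := girth_e c; rewrite c2 leq_max cg => /(_ isT)/negP; apply.
  exact: cyc_c.
- by apply/eqP; rewrite eqn_leq ao3 (leq_trans aoro ro3).
- by apply/eqP; rewrite eqn_leq ro3 (leq_trans ao3 aoro).
- exact: (@layered_max_path H p l layH x s xs size_s).
(* The two predicates agree at every [n], hence so do their least elements, finite or not. *)
rewrite /compressibility /r_tr; congr (least _); apply/funext => n.
apply/propext; split=> [[n0 homs] T tT cT|cont].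
  have [small|large] := leqP n (2 ^ p); last first.
    by apply: large_tournament_contains => //; rewrite cT ltnW.
  have [f homf] := homs T tT cT.
  have [|tf Htf] := tr_e T f; first by rewrite cT.
  apply: (@contains_transitive_tournament T p tf); first by case: tT.
  by move=> i j /Htf[u [v [_ <- _ <- uv]]]; exact: homf.
split=> [|T tT cT].
  (* For [n = 0] the empty tournament would contain [p] vertices. *)
  case: n cont => // cont; pose T0 := @Digraph void (fun _ _ => false).
  have tT0 : tournament T0 by split; case.
  have [f _] := cont T0 tT0 card_void.
  by case: (f (Ordinal p2)).
(* The layer map [l] is a homomorphism to the transitive tournament. *)
have [f [_ homf]] := cont T tT cT; exists (f \o l) => u v uv.
by apply: homf; exact: lay.
Qed.
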